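(* Let $n\ge2$ and $\omega=e^{2\pi i/n}$, $F_n=\frac1{\sqrt n}(\omega^{jk})_{0\le j,k\le n-1}$. (1) If $n$ is a prime power, then for every tuple of nonnegative integers $(s_0,\dots,s_{n-1})$ with $\sum_is_i=n$ we have $\langle s_0,\dots,s_{n-1}|\hat F_n|1,\dots,1\rangle\neq0$ if and only if $\sum_i i\,s_i\equiv0\pmod n$ (the Zero Transmission Law). In particular, the ideal patterns of $F_n$ are exactly the tuples with $\sum_is_i=n$, $s_0=1$ and $\sum_i i\,s_i\equiv0\pmod n$. (2) If $n>1$ is not a prime power, there exists a tuple $(s_0,\dots,s_{n-1})$ with $\sum_is_i=n$, $s_0=1$ and $\sum_i i\,s_i\equiv0\pmod n$ which is not an ideal pattern, i.e. $\langle s_0,\dots,s_{n-1}|\hat F_n|1,\dots,1\rangle=0$.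
   Context: $\hat U$ denotes the linear optical unitary on $n$ bosons in $n$ modes induced by the $n\times n$ unitary $U$ via $a_j^\dagger\mapsto\sum_iU_{ij}a_i^\dagger$; $|s_0,\dots,s_{n-1}\rangle$ is the Fock state with $s_i$ photons in mode $i$, and $|1,\dots,1\rangle$ has one photon in each mode. An ideal pattern of $U$ is a tuple $(s_0,\dots,s_{n-1})$ with $\sum s_i=n$, $s_0=1$ and $\langle s_0,\dots,s_{n-1}|\hat U|1,\dots,1\rangle\ne0$. *)

(* Defs.v *)
From mathcomp Require Import all_boot all_order all_algebra.
From mathcomp Require Import complex.
From mathcomp Require Import reals trigo.
Set Implicit Arguments. Unset Strict Implicit. Unset Printing Implicit Defensive.
Import Order.TTheory GRing.Theory Num.Theory.
Local Open Scope ring_scope.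
Local Open Scope complex_scope.

Definition omega (R : realType) (n : nat) : R[i] :=
  (cos (2 * pi / n%:R)) +i* (sin (2 * pi / n%:R)).

Definition fourier (R : realType) (n : nat) : 'M[R[i]]_n :=
  \matrix_(j < n, k < n) (((Num.sqrt (n%:R : R))^-1)%:C * omega R n ^+ (j * k)).

(* <s_0,...,s_{n-1}| U^ |1,...,1> : expanding U^|1..1> = prod_j (sum_i U_ij a_i^dag)|0>
   gives sum_f prod_j U_{f j, j} prod_j a_{f j}^dag |0>, and
   prod_i (a_i^dag)^{s_i} |0> = sqrt(prod_i s_i!) |s>. *)
Definition amplitude (R : realType) (n : nat) (U : 'M[R[i]]_n) (s : 'I_n -> nat) : R[i] :=
  (Num.sqrt ((\prod_(i < n) (s i)`!)%:R : R))%:C *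
  \sum_(f : {ffun 'I_n -> 'I_n} | [forall i, #|[set j | f j == i]| == s i])
     \prod_(j < n) U (f j) j.

Definition ideal_pattern (R : realType) (n : nat) (U : 'M[R[i]]_n) (s : 'I_n -> nat) : Prop :=
  (\sum_(i < n) s i)%N = n /\
  (forall i : 'I_n, nat_of_ord i = 0%N -> s i = 1%N) /\
  amplitude U s != 0.

Definition prime_power (n : nat) : Prop :=
  exists p k : nat, prime p /\ (0 < k)%N /\ n = (p ^ k)%N.

(* Main.v *)
(* Expanding the amplitude over bijections reduces everything to the sums
   [T(l) = \sum_j \prod_i w ^ (l_i j_i)] over injective families [j] of residues
   mod [n], with [w] a primitive [n]-th root of unity.  Letting the first index
   run freely and subtracting collisions gives the recurrence
   [T(x :: l) = p(x) T(l) - \sum_(y in l) T((x + y) :: (l minus y))], where [p(x)]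
   is [n] if [n] divides [x] and [0] otherwise; hence [T(l) = 0] unless the sum of
   [l] is divisible by [n].

   If [n = p ^ v] and [l] has [k + 1 <= n] entries summing to [0] mod [n], the
   recurrence shows that [T(l)] is [(-1) ^ k n k!] up to terms of higher [p]-adic
   valuation, so [T(l) <> 0].

   If [n] is not a prime power, the Chinese remainder theorem yields
   [0 < M < n - 1] with [2n | M (M + 1)].  Put [h = M (M + 1) / 2n] and [a = M - h].
   The list made of [M - 1] ones, [-a] twice and [2a - M + 1] once has
   [T = (-1) ^ (M - 1) (M - 1)! n (M (M + 1) - 2 n h) = 0].  Padding it with zeros to
   length [n] keeps [T = 0], and so does adding a constant to all entries, which
   moves the entry [2a - M + 1] of multiplicity one to [0]. *)
Require Import Defs.
From mathcomp Require Import all_boot all_order all_algebra.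
From mathcomp Require Import complex.
From mathcomp Require Import reals trigo.
From mathcomp Require Import zify ring lra.
Import Order.TTheory GRing.Theory Num.Theory.
Local Open Scope ring_scope.
Set Implicit Arguments.
Unset Strict Implicit.
Unset Printing Implicit Defensive.

(** * Valuations of factorials *)

Section Factorials.
Local Open Scope nat_scope.

Lemma logn_fact_lt p v m :
  prime p -> m < p ^ v -> logn p m`! = \sum_(1 <= k < v) m %/ p ^ k.
Proof.
move=> p_pr lt_m; rewrite logn_fact //.
have extend u t : m < p ^ u -> u <= t ->
    \sum_(1 <= k < t) m %/ p ^ k = \sum_(1 <= k < u) m %/ p ^ k.
  move=> lt_mu; elim: t => [|t IHt]; first by rewrite leqn0 => /eqP ->.
  rewrite leq_eqVlt ltnS => /predU1P[-> //|le_ut].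
  case: t IHt le_ut => [_|t IHt le_ut].
    by rewrite leqn0 => /eqP ->; rewrite !big_geq.
  rewrite big_nat_recr //= IHt // divn_small ?addn0 //.
  by rewrite (leq_trans lt_mu) // leq_pexp2l // prime_gt0.
rewrite -(extend m.+1 (maxn v m.+1)) ?leq_maxr ?(extend v) ?leq_maxl //.
by rewrite (leq_trans (ltn_expl m (prime_gt1 p_pr))) // leq_pexp2l // prime_gt0.
Qed.

(** For each [k], the quotient of [b + c + 1] by [p ^ k] exceeds the sum of those of [b] and [c] by
    at most one, and only the [v - 1] exponents [1 <= k < v] count. *)
Lemma logn_fact_split p v b c :
  prime p -> b + c.+1 < p ^ v ->
  logn p (b + c.+1)`! < v + logn p b`! + logn p c`!.
Proof.
move=> p_pr lt_bc; have v_gt0 : 0 < v by case: v lt_bc => //; rewrite expn0; lia.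
rewrite !(@logn_fact_lt p v) //; try lia.
have -> : v + \sum_(1 <= k < v) b %/ p ^ k + \sum_(1 <= k < v) c %/ p ^ k
    = (\sum_(1 <= k < v) (b %/ p ^ k + c %/ p ^ k + 1)).+1.
  rewrite !big_split /= sum_nat_const_nat; lia.
rewrite ltnS; apply: leq_sum => k _.
have q_gt0 : 0 < p ^ k by rewrite expn_gt0 prime_gt0.
move: (p ^ k) q_gt0 => q q_gt0.
rewrite -ltnS ltn_divLR //.
have := ltn_ceil b q_gt0; have := ltn_ceil c q_gt0; nia.
Qed.

End Factorials.

(** * Integer divisibility inside a field of characteristic zero *)

Section IntegerMultiples.
Variable F : numFieldType.
Implicit Types (d e : nat) (z : F).

(** Allows [p]-adic estimates on sums of roots of unity, which live in [F]. *)
Definition int_multiple d z := exists y : int, z = y%:~R * d%:R.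

Lemma int_multiple0 d : int_multiple d 0.
Proof. by exists 0; rewrite mul0r. Qed.

Lemma int_multipleD d z1 z2 :
  int_multiple d z1 -> int_multiple d z2 -> int_multiple d (z1 + z2).
Proof. by move=> [y1 ->] [y2 ->]; exists (y1 + y2); rewrite rmorphD mulrDl. Qed.

Lemma int_multipleM d e z1 z2 :
  int_multiple d z1 -> int_multiple e z2 -> int_multiple (d * e) (z1 * z2).
Proof.
by move=> [y1 ->] [y2 ->]; exists (y1 * y2); rewrite rmorphM natrM mulrACA.
Qed.

Lemma int_multiple_dvd d e z : (d %| e)%N -> int_multiple e z -> int_multiple d z.
Proof.
move=> /dvdnP[q ->] [y ->]; exists (y * q%:Z).
by rewrite natrM mulrA rmorphM.
Qed.

Lemma int_multiple_nat d e : int_multiple d (e%:R : F) <-> (d %| e)%N.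
Proof.
split=> [[y]|dvd_de]; last by apply: int_multiple_dvd dvd_de _; exists 1; rewrite mul1r.
move/eqP; rewrite -[e%:R]/(e%:Z%:~R) -[d%:R]/(d%:Z%:~R) -rmorphM /= eqr_int.
by move=> /eqP eq_e; rewrite -[(d %| e)%N]/(d%:Z %| e%:Z)%Z; apply/dvdzP; exists y.
Qed.

End IntegerMultiples.

(** * Pronic numbers divisible by [2n] *)

Lemma exists_dvdn_pronic n :
  (1 < n)%N -> ~ prime_power n ->
  exists M, [/\ (0 < M)%N, (M.+1 < n)%N & (2 * n %| M * M.+1)%N].
Proof.
move=> n_gt1 npp; pose p := pdiv n.
have p_pr : prime p by apply: pdiv_prime.
have p_gt1 := prime_gt1 p_pr.
have dvd_pn : (p %| n)%N by apply: pdiv_dvd.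
have N_gt0 : (0 < 2 * n)%N by lia.
pose P := ((2 * n)`_p)%N; pose Q := ((2 * n)`_p^')%N.
have PQ : (P * Q = 2 * n)%N by apply: partnC.
have coPQ : coprime P Q by apply: coprime_partC.
have dvd_pP : (p %| P)%N.
  by rewrite /P p_part dvdn_exp // logn_gt0 mem_primes p_pr N_gt0 dvdn_mull.
have p_pow m : (1 < m)%N -> p.-nat m -> prime_power m.
  move=> m_gt1 m_nat; exists p, (logn p m); split=> //.
  have mE : m = (p ^ logn p m)%N by rewrite -p_part part_pnat_id.
  split=> //; rewrite lt0n; apply/eqP => log0.
  by move: m_gt1; rewrite mE log0.
have Q_neq1 : Q != 1%N.
  apply/eqP => Q1; apply: npp; apply: p_pow => //.
  apply: (@pnat_dvd _ P); last by apply: part_pnat.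
  by rewrite -[P]muln1 -Q1 PQ dvdn_mull.
have Q_neq2 : Q != 2%N.
  apply/eqP => Q2; apply: npp; apply: p_pow => //.
  have -> : n = P by apply/eqP; rewrite -(eqn_pmul2r (isT : 0 < 2)%N) -Q2 PQ Q2 mulnC.
  exact: part_pnat.
(* [M] is [0] mod [P] and [-1] mod [Q], so [P * Q = 2n] divides [M (M + 1)]. *)
pose M := (chinese P Q 0 Q.-1 %% (2 * n))%N.
have Q_gt0 : (0 < Q)%N by apply: part_gt0.
have ltM : (M < 2 * n)%N by apply: ltn_pmod.
have dvdP : (P %| M)%N.
  by rewrite /M -PQ /dvdn modn_dvdm ?dvdn_mulr // chinese_modl // mod0n.
have dvdQ : (Q %| M.+1)%N.
  rewrite -addn1 /dvdn -modnDml /M -PQ modn_dvdm ?dvdn_mull //.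
  by rewrite chinese_modr // modnDml addn1 prednK // modnn.
have dvdM : (2 * n %| M * M.+1)%N by rewrite -PQ dvdn_mul.
have M_gt0 : (0 < M)%N.
  rewrite lt0n; apply/eqP => M0; move: dvdQ; rewrite M0 dvdn1; exact/negP.
clearbody M P Q.
have P_gt1 : (1 < P)%N.
  by rewrite (leq_trans p_gt1) // dvdn_leq //; move: N_gt0; rewrite -PQ; case: (P).
(* Besides [0], the values [n - 1], [n] and [2n - 1] are those for which neither [M] nor
   [2n - 1 - M] falls in the required range. *)
have M_neq1 : M.+1 != n.
  apply/eqP => Mn.
  have dvd2 : (P %| 2)%N.
    rewrite (_ : 2 = 2 * n - 2 * M)%N; [|lia].
    by apply: dvdn_sub; [rewrite -PQ dvdn_mulr | rewrite dvdn_mull].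
  have p2 : p = 2%N by apply/eqP; rewrite -(dvdn_prime2 p_pr) // (dvdn_trans dvd_pP).
  have : (2 %| M)%N by rewrite -p2 (dvdn_trans dvd_pP).
  by move: dvd_pn; rewrite p2 -Mn !dvdn2 /= => /negPf ->.
have M_neq : M != n.
  apply/eqP => Mn.
  have dvd2 : (Q %| 2)%N.
    rewrite (_ : 2 = 2 * M.+1 - 2 * n)%N; [|lia].
    by apply: dvdn_sub; [rewrite dvdn_mull | rewrite -PQ dvdn_mull].
  have /primeP[_ /(_ Q dvd2)] : prime 2 by [].
  by rewrite (negPf Q_neq1) (negPf Q_neq2).
have M_neq2 : (M.+1 != 2 * n)%N.
  apply/eqP => M2n; have : (P %| M.+1 - M)%N by rewrite dvdn_sub // M2n -PQ dvdn_mulr.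
  rewrite subSnn dvdn1; lia.
(* [M |-> 2n - 1 - M] preserves [M (M + 1)] modulo [2n]. *)
have [lt_Mn | le_nM] := ltnP M.+1 n; first by exists M.
exists (2 * n - M.+1)%N; split; [lia|lia|].
rewrite -(dvdn_addl _ (dvdn_mulr M.*2.+1 (dvdnn (2 * n)))).
have [d nE] : exists d, (2 * n = M.+1 + d)%N by exists (2 * n - M.+1)%N; lia.
have -> : ((2 * n - M.+1) * (2 * n - M.+1).+1 + 2 * n * M.*2.+1
           = 2 * n * (2 * n) + M * M.+1)%N.
  by rewrite nE addKn -muln2; lia.
by rewrite dvdn_add // dvdn_mulr.
Qed.

(** * Sums over injective families and their merging recurrence *)

Section InjectiveSums.
Variables (F : comNzRingType) (n : nat) (w : F).
Implicit Types (l : seq nat) (V : {set 'I_n}).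

(** When [size l = #|V|] this is the permanent of the matrix with entries [w ^+ (x * j)], for [x] in
    [l] and [j] in [V]. *)
Fixpoint inj_sum l V : F :=
  if l is x :: l' then \sum_(j in V) w ^+ (x * j) * inj_sum l' (V :\ j) else 1.

Lemma inj_sum_swap x y l V : inj_sum [:: x, y & l] V = inj_sum [:: y, x & l] V.
Proof.
rewrite /=.
under eq_bigr => j _ do rewrite big_distrr.
under [RHS]eq_bigr => j _ do rewrite big_distrr.
rewrite (exchange_big_dep (mem V)) /=; last by move=> i j _ /setD1P[].
apply: eq_bigr => j jV; apply: eq_big => [i|i _].
  by rewrite !inE jV eq_sym; case: (_ \in V); rewrite ?andbF ?andbT.
by rewrite setDDl setUC -setDDl mulrCA.
Qed.

Lemma perm_inj_sum l1 l2 V : perm_eq l1 l2 -> inj_sum l1 V = inj_sum l2 V.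
Proof.
have front x u v V' : inj_sum (u ++ x :: v) V' = inj_sum (x :: u ++ v) V'.
  elim: u V' => // y u IHu V'; rewrite cat_cons inj_sum_swap /=.
  by apply: eq_bigr => j _; rewrite IHu.
elim: l1 l2 V => [|x l1 IHl] l2 V; first by rewrite perm_sym => /perm_nilP ->.
move=> eq12; have xl2: x \in l2 by rewrite -(perm_mem eq12) mem_head.
case/splitPr: xl2 eq12 => u v eq12; rewrite front /=.
apply: eq_bigr => j _; congr (_ * _); apply: IHl.
rewrite -(perm_cons x) (perm_trans eq12) //.
by rewrite -cat1s perm_catCA.
Qed.

(** A collision of the index of [x] with that of [y] merges the two factors into one with exponent
    [x + y]. The induction exposes the head [y] by [inj_sum_swap]. *)
Lemma inj_sum_cons x l V :
  inj_sum (x :: l) V =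
  (\sum_(j in V) w ^+ (x * j)) * inj_sum l V
  - \sum_(y <- l) inj_sum ((x + y)%N :: rem y l) V.
Proof.
elim: l V => [|y l IHl] V; first by rewrite big_nil subr0 /= big_distrl.
pose P := \sum_(j in V) w ^+ (x * j).
rewrite inj_sum_swap.
transitivity (\sum_(k in V) (P * (w ^+ (y * k) * inj_sum l (V :\ k))
   - w ^+ ((x + y) * k) * inj_sum l (V :\ k)
   - \sum_(z <- l)
       w ^+ (y * k) * inj_sum ((x + z)%N :: rem z l) (V :\ k))).
  apply: eq_bigr => k kV; rewrite -/(inj_sum (x :: l) (V :\ k)) IHl.
  have -> : \sum_(j in V :\ k) w ^+ (x * j) = P - w ^+ (x * k).
    by rewrite /P (big_setD1 k kV) /= [RHS]addrAC subrr add0r.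
  by rewrite -big_distrr mulnDl exprD /=; ring.
rewrite !sumrB -big_distrr big_cons /= eqxx opprD addrA; congr (_ - _).
rewrite exchange_big; apply: eq_big_seq => z zl /=.
transitivity (inj_sum [:: y, (x + z)%N & rem z l] V); first by [].
rewrite inj_sum_swap.
apply: (@perm_inj_sum _ ((x + z)%N :: if y == z then l else y :: rem z l)).
rewrite perm_cons.
by case: eqP => [->|//]; rewrite perm_sym perm_to_rem.
Qed.

(** By the size hypothesis every index of [V] is used exactly once, so the extra factor is the same
    for every injective family. *)
Lemma inj_sum_shift t l V :
  size l = #|V| ->
  inj_sum [seq (x + t)%N | x <- l] V = w ^+ (\sum_(j in V) t * j) * inj_sum l V.
Proof.
elim: l V => [|x l IHl] V /= szl.
  by rewrite (cards0_eq (esym szl)) big_set0 mul1r.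
rewrite big_distrr; apply: eq_bigr => j jV /=.
rewrite IHl; last by rewrite (cardsD1 j) jV in szl; case: szl.
by rewrite (big_setD1 j jV) /= mulnDl !exprD; ring.
Qed.

End InjectiveSums.

(** * Injective sums over all residues, for a primitive root of unity *)

Section RootOfUnity.
Variables (F : numFieldType) (n : nat) (w : F).
Hypothesis prim_w : n.-primitive_root w.
Implicit Types (l : seq nat).

Let n_gt0 : (0 < n)%N := prim_order_gt0 prim_w.
Definition root_sum l : F := inj_sum w l [set: 'I_n].
Definition psum x : F := if (n %| x)%N then n%:R else 0.

Lemma root_sum_mod l1 l2 :
  [seq (x %% n)%N | x <- l1] = [seq (x %% n)%N | x <- l2] ->
  root_sum l1 = root_sum l2.
Proof.
rewrite /root_sum; elim: l1 l2 [set: _] => [|x l1 IHl] [|y l2] //= V [xy l12].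
apply: eq_bigr => j _; rewrite (IHl l2) // !exprM.
by rewrite -(prim_expr_mod prim_w x) xy prim_expr_mod.
Qed.

Lemma psumE x : \sum_(j in [set: 'I_n]) w ^+ (x * j) = psum x.
Proof.
under eq_bigl => j do rewrite inE.
under eq_bigr => j _ do rewrite exprM.
rewrite /psum (prim_order_dvd prim_w); case: eqP => [->|/eqP wx1].
  by under eq_bigr => j _ do rewrite expr1n; rewrite sumr_const card_ord.
have := subrX1 (w ^+ x) n; rewrite exprAC (prim_expr_order prim_w) expr1n subrr.
by move/esym/eqP; rewrite mulf_eq0 subr_eq0 (negPf wx1) => /eqP.
Qed.

Lemma root_sum_cons x l :
  root_sum (x :: l) =
  psum x * root_sum l - \sum_(y <- l) root_sum ((x + y)%N :: rem y l).
Proof. by rewrite /root_sum inj_sum_cons psumE. Qed.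

Lemma perm_root_sum l1 l2 : perm_eq l1 l2 -> root_sum l1 = root_sum l2.
Proof. exact: perm_inj_sum. Qed.

(** Merging shortens the list without changing its total, and dropping an [x] with [psum x != 0]
    keeps the total mod [n]. *)
Lemma root_sum_eq0 l : ~~ (n %| sumn l)%N -> root_sum l = 0.
Proof.
have [k] := ubnP (size l); elim: k l => // k IHk [|x l] /=; first by rewrite dvdn0.
rewrite ltnS => szl ndvd; rewrite root_sum_cons big_seq big1 => [|y yl].
  rewrite subr0 /psum; case: ifP => [dx|_]; last by rewrite mul0r.
  by rewrite IHk ?mulr0 // -(dvdn_addr _ dx).
apply: IHk => /=.
  by rewrite size_rem // (leq_trans _ szl) // ltnS; case: (l) yl.
by rewrite -addnA -[(y + _)%N]/(sumn (y :: _)) -(perm_sumn (perm_to_rem yl)).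
Qed.

(** Merging [0] into any entry gives back [l] up to order. *)
Lemma root_sum_cons0 l : root_sum l = 0 -> root_sum (0%N :: l) = 0.
Proof.
move=> l0; rewrite root_sum_cons l0 mulr0 big_seq big1 ?subrr // => y yl.
by rewrite add0n -(perm_root_sum (perm_to_rem yl)).
Qed.

(** * Closed forms for lists made mostly of ones *)

Lemma sum_merge_nseq1 x u i :
  \sum_(y <- nseq i.+1 1%N) root_sum ((x + y)%N :: rem y (u ++ nseq i.+1 1%N)) =
  i.+1%:R * root_sum (x.+1 :: u ++ nseq i 1%N).
Proof.
rewrite big_nseq iter_addr_0 mulr_natl addn1; congr (_ *+ _).
apply: perm_root_sum; rewrite perm_cons -(perm_cons 1%N).
have one_in : 1%N \in u ++ nseq i.+1 1%N by rewrite mem_cat mem_head orbT.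
rewrite -(permPl (perm_to_rem one_in)).
exact: (permEl (perm_catCA u [:: 1%N] (nseq i 1%N))).
Qed.

(** Fewer than [n] ones never sum to a multiple of [n], so only merges survive until [x] has
    absorbed every one. *)
Lemma root_sum_nseq1 x i :
  (i < n)%N -> (n %| x + i)%N ->
  root_sum (x :: nseq i 1%N) = (-1) ^+ i * (i`! * n)%:R.
Proof.
elim: i x => [|i IHi] x lt_in dvd.
  rewrite addn0 in dvd; rewrite root_sum_cons big_nil /psum dvd /root_sum /=.
  by rewrite subr0 mulr1 mul1r mul1n.
rewrite root_sum_cons root_sum_eq0; last first.
  by rewrite sumn_nseq mul1n gtnNdvd.
rewrite (sum_merge_nseq1 _ [::]) IHi; [|lia|by rewrite addSnnS].
by rewrite factS exprS !natrM; ring.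
Qed.

(** After absorbing [a] ones [x] becomes a multiple of [n], whence the term with [n]. Absorbing [y]
    after [0] to [i] ones contributes equally each time, whence [i.+1]. *)
Lemma root_sum2_nseq1 x a y i :
  (a < n)%N -> (i.+1 < n)%N -> (n %| x + a)%N -> (n %| x + (y + i))%N ->
  root_sum [:: x, y & nseq i 1%N] =
  (-1) ^+ i * (i`! * n)%:R * ((n * (a <= i))%:R - i.+1%:R).
Proof.
elim: i x a => [|i IHi] x a lt_an lt_in dvd_xa dvd_xyi.
  rewrite root_sum_cons big_seq1 /= eqxx (@root_sum_nseq1 (x + y) 0) -?addnA //.
  rewrite /psum; case: a lt_an dvd_xa => [|a] lt_an dvd_xa.
    rewrite addn0 in dvd_xa; rewrite dvd_xa (@root_sum_nseq1 y 0) //; last first.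
      by rewrite -(dvdn_addr _ dvd_xa).
    by rewrite !muln1 expr0 mul1r mul1n; ring.
  rewrite ifN ?muln0; first by ring.
  by apply/negP => dvd_x; rewrite dvdn_addr // gtnNdvd in dvd_xa.
rewrite root_sum_cons big_cons [rem y _]/= eqxx (sum_merge_nseq1 _ [:: y]).
rewrite (@root_sum_nseq1 (x + y) i.+1); [|lia|by rewrite -addnA].
rewrite /psum.
case: a lt_an dvd_xa => [|a] lt_an dvd_xa.
  rewrite addn0 in dvd_xa; rewrite dvd_xa root_sum_nseq1; [|lia|].
    (* Past a multiple of [n], another [n - 1] ones would be needed to reach the next; too few
       remain. *)
    rewrite (IHi _ n.-1); [|lia|lia| |].
    - rewrite (_ : (n.-1 <= i)%N = false); last by lia.
      rewrite !muln0 muln1.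
      by rewrite factS exprS !natrM -!natr1; ring.
    - by rewrite addSnnS prednK // dvdn_addr.
    - by rewrite addSnnS -addnS.
  by rewrite -(dvdn_addr _ dvd_xa).
rewrite ifN; last first.
  by apply/negP => dvd_x; rewrite dvdn_addr // gtnNdvd in dvd_xa.
rewrite (IHi _ a); [|lia|lia| |].
- rewrite ltnS.
  by rewrite factS exprS !natrM -!natr1; ring.
- by rewrite addSnnS.
- by rewrite addSnnS -addnS.
Qed.

(* The exponent [x] stands for [2a - i], which makes the sum [0] mod [n]. *)
Lemma root_sum3_nseq1 x a y i :
  (a.*2 < n)%N -> (0 < x)%N -> (x + i = a.*2)%N -> (n %| y + a)%N ->
  root_sum [:: x, y, y & nseq i 1%N] =
  (-1) ^+ i * (i`! * n)%:R * ((i.+1 * i.+2)%:R - (2 * n * (i.+1 - a))%:R).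
Proof.
move=> lt_an; have npsum x' : (0 < x')%N -> (x' < n)%N -> psum x' = 0.
  by move=> x'_gt0 lt_x'n; rewrite /psum gtnNdvd.
have pair j x' : (0 < x')%N -> (x' + j = a.*2)%N -> (n %| y + a)%N ->
    root_sum [:: (x' + y)%N, y & nseq j 1%N]
    = (-1) ^+ j * (j`! * n)%:R * ((n * (a <= j))%:R - j.+1%:R).
  move=> x'_gt0 x'j dvd_ya.
  (* Taking [y] as the absorbing entry makes [a] the number of ones it needs. *)
  rewrite (@perm_root_sum _ [:: y, (x' + y)%N & nseq j 1%N]); last first.
    exact: (permEl (perm_catCA [:: (x' + y)%N] [:: y] _)).
  apply: root_sum2_nseq1 => //; try lia.
  have -> : (y + (x' + y + j) = (y + a) + (y + a))%N by lia.
  exact: dvdn_add.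
elim: i x => [|i IHi] x x_gt0 xi dvd_ya.
  rewrite root_sum_cons npsum //; [|lia].
  rewrite big_cons big_seq1 /= eqxx (pair 0%N) //.
  rewrite !expr0 !mul1r fact0 mul1n.
  by case: a lt_an xi {pair dvd_ya} => [|a] /=; [lia | move=> _ _; rewrite !muln0; ring].
rewrite root_sum_cons npsum //; [|lia].
rewrite 2!big_cons (sum_merge_nseq1 _ [:: y; y]) /= !eqxx.
rewrite -[1%N :: nseq i 1%N]/(nseq i.+1 1%N) (pair i.+1) //.
rewrite IHi; [|lia|lia|by []].
(* The truncated difference grows only once [a <= i.+1], matching the indicator from [pair]. *)
have -> : (i.+2 - a = (i.+1 - a) + (a <= i.+1))%N by lia.
by rewrite factS exprS !natrM !natrD -!natr1; ring.
Qed.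

(* The merges of [x] with the elements of [A] in [root_sum_cons] are iterated;
   a block [B] absorbed by [x] arises from the [#|B|`!] orders of absorption. *)
Lemma root_sum_subsets (I : finType) (a : I -> nat) x (A : {set I}) :
  root_sum (x :: [seq a i | i <- enum A]) =
  \sum_(B : {set I} | B \subset A)
     psum (x + \sum_(i in B) a i) * ((-1) ^+ #|B| * #|B|`!%:R)
     * root_sum [seq a i | i <- enum (A :\: B)].
Proof.
have [k] := ubnP #|A|; elim: k A x => // k IHk A x; rewrite ltnS => leAk.
pose f (B : {set I}) :=
  psum (x + \sum_(i in B) a i) * root_sum [seq a i | i <- enum (A :\: B)].
pose c m : F := (-1) ^+ m * m`!%:R.
have merge i : i \in A ->
    root_sum ((x + a i)%N :: rem (a i) [seq a i | i <- enum A])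
    = \sum_(B : {set I} | (B \subset A) && (i \in B)) c #|B|.-1 * f B.
  move=> iA.
  rewrite (@perm_root_sum _ ((x + a i)%N :: [seq a i | i <- enum (A :\ i)])).
    rewrite IHk; last by rewrite (leq_trans _ leAk) // [ltnRHS](cardsD1 i) iA.
    rewrite [RHS](reindex_onto (fun B => i |: B) (fun B => B :\ i)) /=; last first.
      by move=> B /andP[_ iB]; rewrite setD1K.
    apply: eq_big => [B|B].
      rewrite setU11 andbT subUset sub1set iA subsetD1 /=.
      case: (boolP (i \in B)) => iB; last by rewrite setU1K // eqxx !andbT.
      by rewrite andbF; apply/esym/negP => /andP[_ /eqP eqB]; rewrite -eqB setD11 in iB.
    rewrite subsetD1 => /andP[_ niB].
    rewrite cardsU1 niB /f big_setU1 //= addnA setDDl.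
    by rewrite mulrAC mulrC.
  rewrite perm_cons -(perm_cons (a i)).
  have ai_in : a i \in [seq a i | i <- enum A] by rewrite map_f // mem_enum.
  rewrite -(permPl (perm_to_rem ai_in)) -map_cons; apply: perm_map.
  apply: uniq_perm; rewrite /= ?enum_uniq ?mem_enum ?setD11 // => j.
  by rewrite inE !mem_enum !inE; case: eqP => [->|].
rewrite root_sum_cons // big_map big_enum /=.
rewrite (eq_bigr _ merge) (exchange_big_dep (fun B : {set I} => B \subset A)) /=; last first.
  by move=> i B _ /andP[].
rewrite [RHS](bigD1 set0) ?sub0set //= big_set0 addn0 cards0 mulr1 mulr1 setD0.
congr (_ + _); rewrite (bigD1 set0) ?sub0set //= big1 => [|i]; last first.
  by rewrite inE andbF.
rewrite add0r -sumrN; apply: eq_bigr => B /andP[sBA nzB].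
(* Each element of [B] may be the first absorbed, which turns [(#|B| - 1)!] into [#|B|!]. *)
rewrite (eq_bigl (mem B)) => [|i]; last first.
  by rewrite sBA /=; apply: andb_idl => /(subsetP sBA).
rewrite sumr_const /f -mulr_natl /c.
have : (0 < #|B|)%N by rewrite card_gt0.
case: #|B| => // m _; rewrite factS exprS natrM /=; ring.
Qed.

(* In [root_sum_subsets], the block absorbing the whole list contributes
   [(-1) ^+ k * (n * k`!)]; every other block leaves a second factor [n], which
   dominates the possible loss of valuation in [k`!] because [k < n]. *)
Lemma root_sum_congr p v l k :
  prime p -> n = (p ^ v)%N -> size l = k.+1 -> (k < n)%N -> (n %| sumn l)%N ->
  int_multiple (p ^ (v + logn p k`!).+1) (root_sum l - (-1) ^+ k * (n * k`!)%:R).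
Proof.
move=> p_pr nE; elim/ltn_ind: k l => k IHk [|x l] // [szl] lt_kn dvd_l.
pose a (i : 'I_(size l)) := nth 0%N l i.
have sum_a (B : {set 'I_(size l)}) :
    sumn [seq a i | i <- enum B] = (\sum_(i in B) a i)%N.
  by rewrite sumnE big_map big_enum.
(* Blocks are sets of positions, since entries may repeat. *)
have lE : l = [seq a i | i <- enum [set: 'I_(size l)]].
  by rewrite enum_setT -enumT (map_comp (nth 0%N l)) val_enum_ord map_nth_iota0 ?take_size.
rewrite {1}lE root_sum_subsets // (bigD1 setT) //=.
have cardT : #|[set: 'I_(size l)]| = k by rewrite cardsT card_ord.
rewrite cardT setDv enum_set0 /= -sum_a -lE.
rewrite {1}/psum dvd_l -[X in _ * _ * X + _]/(1 : F) mulr1.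
rewrite natrM [in X in _ - X]mulrCA addrAC subrr add0r.
elim/big_rec: _ => [|B z /andP[_ ntB] zmul]; first exact: int_multiple0.
apply: int_multipleD zmul.
rewrite /psum; case: ifP => [dvdB|_]; last by rewrite !mul0r; apply: int_multiple0.
have cardBC : (#|B| + #|~: B| = k)%N by rewrite -cardT cardsT cardsC.
have : (0 < #|~: B|)%N.
  by rewrite card_gt0 -(inj_eq (can_inj (@setCK _))) setCK setC0.
case cE : #|~: B| => [|c] // _; rewrite cE in cardBC.
have dvdC : (n %| \sum_(i in ~: B) a i)%N.
  rewrite -(dvdn_addr _ dvdB) -addnA; rewrite [sumn _]/= lE sum_a in dvd_l.
  have -> // : (\sum_(i in B) a i + \sum_(i in ~: B) a i = \sum_(i in setT) a i)%N.
  by rewrite [RHS](big_setID B) /= setTI setTD.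
have Tmul : int_multiple (p ^ (v + logn p c`!))
    (root_sum [seq a i | i <- enum ([set: 'I_(size l)] :\: B)]).
  rewrite setTD -[root_sum _](subrK ((-1) ^+ c * (n * c`!)%:R)).
  apply: int_multipleD.
    apply: (@int_multiple_dvd _ _ (p ^ (v + logn p c`!).+1)).
      by rewrite expnS dvdn_mull.
    by apply: IHk; rewrite ?size_map -?cardE ?cE ?sum_a //; lia.
  rewrite -[(p ^ _)%N]mul1n; apply: int_multipleM.
    by exists ((-1) ^+ c); rewrite mulr1 rmorphXn rmorphN.
  by apply/int_multiple_nat; rewrite expnD nE dvdn_mul // pfactor_dvdnn.
have sgn_mul : int_multiple 1 ((-1) ^+ #|B| : F).
  by exists ((-1) ^+ #|B|); rewrite mulr1 rmorphXn rmorphN.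
have fact_mul m : int_multiple m%N (m%:R : F) by apply/int_multiple_nat.
apply: int_multiple_dvd
  (int_multipleM (int_multipleM (fact_mul n) (int_multipleM sgn_mul (fact_mul _))) Tmul).
(* [k = #|B| + c + 1], so [logn_fact_split] gives the one extra factor [p]. *)
apply: (@dvdn_trans (p ^ v * p ^ logn p #|B|`! * p ^ (v + logn p c`!))).
  rewrite -!expnD dvdn_exp2l // -cardBC -addnS.
  have := @logn_fact_split p v #|B| c p_pr; rewrite cardBC -nE; lia.
by rewrite dvdn_mul // nE mul1n dvdn_mul // pfactor_dvdnn.
Qed.

(** Vanishing would make [n * k!] divisible by one more power of [p] than its valuation allows. *)
Lemma root_sum_neq0 p v l :
  prime p -> n = (p ^ v)%N -> (0 < size l <= n)%N -> (n %| sumn l)%N ->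
  root_sum l != 0.
Proof.
move=> p_pr nE /andP[]; case szl : (size l) => [|k] // _ lt_kn dvd_l.
apply/eqP => l0; have := root_sum_congr p_pr nE szl lt_kn dvd_l.
rewrite l0 sub0r => -[y eq_y].
have : int_multiple (p ^ (v + logn p k`!).+1) ((n * k`!)%:R : F).
  exists (- (-1) ^+ k * y).
  by rewrite intrM mulrNz rmorphXn rmorphN -mulrA -eq_y mulrNN signrMK.
move/int_multiple_nat; rewrite pfactor_dvdn // ?muln_gt0 ?n_gt0 ?fact_gt0 //.
by rewrite lognM ?fact_gt0 // nE pfactorK // ltnn.
Qed.

(** * A vanishing sum when [n] is not a prime power *)

Lemma exists_root_sum_eq0 :
  (1 < n)%N -> ~ prime_power n ->
  exists l, [/\ size l = n, all (ltn^~ n) l, (n %| sumn l)%N, count_mem 0%N l = 1%N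
    & root_sum l = 0].
Proof.
move=> n_gt1 /(exists_dvdn_pronic n_gt1)[M [M_gt0 lt_Mn /dvdnP[h hM]]].
have h_gt0 : (0 < h)%N by case: h hM => //; nia.
have lt_hM : (2 * h < M)%N by nia.
pose a := (M - h)%N; pose i := M.-1; pose x := (a.*2 - i)%N; pose y := (n - a)%N.
(* Indeed [n (n - 2a) = (n - M)^2 + M]. *)
have lt_an : (a.*2 < n)%N by rewrite /a; nia.
have xgt1 : (1 < x)%N by rewrite /x /i /a; lia.
have le_xa : (x <= a)%N by rewrite /x /i /a; lia.
pose l0 := nseq (n - M.+2)%N 0%N ++ [:: x, y, y & nseq i 1%N].
have l0_0 : root_sum l0 = 0.
  have : root_sum [:: x, y, y & nseq i 1%N] = 0.
    rewrite (@root_sum3_nseq1 _ a) //; [|lia|lia|by rewrite subnK ?dvdnn //; lia].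
    apply/eqP; rewrite mulf_eq0 subr_eq0; apply/orP; right.
    (* Here [i.+1 = M] and [i.+1 - a = h], so the bracket is [M (M + 1) - 2nh]. *)
    apply/eqP; congr (_%:R); by rewrite /i /a prednK // subKn; [rewrite hM mulnC|lia].
  rewrite /l0; elim: (n - M.+2)%N => // m IHm l1.
  by rewrite /= root_sum_cons0 ?IHm.
(* The shift by [-x] sends exactly the entries equal to [x] to [0]. *)
exists [seq (z + (n - x)) %% n | z <- l0]%N.
have sz : size l0 = n by rewrite size_cat /= !size_nseq /i; lia.
split.
- by rewrite size_map.
- by apply/allP => z /mapP[z' _ ->]; apply: ltn_pmod.
- have mod_sum s : (sumn [seq (z + (n - x)) %% n | z <- s] = sumn s + size s * (n - x) %[mod n])%N.
    elim: s => //= z s IHs; rewrite -modnDm modn_mod IHs modnDm; congr (_ %% _)%N; lia.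
  rewrite /dvdn mod_sum sz -modnDmr modnMr addn0 /l0 sumn_cat !sumn_nseq /= sumn_nseq.
  have -> : (0 * (n - M.+2) + (x + (y + (y + 1 * i))) = n + n)%N by lia.
  by rewrite -modnDm modnn mod0n.
- have mod_eq0 z : (z < n)%N -> ((z + (n - x)) %% n == 0)%N = (z == x).
    move=> lt_zn; rewrite -[_ == _]/(n %| _)%N; apply/idP/eqP => [|->]; last first.
      by rewrite subnKC ?dvdnn //; lia.
    have [lt_zx|le_xz] := ltnP z x; first by rewrite gtnNdvd //; lia.
    have -> : (z + (n - x) = z - x + n)%N by lia.
    rewrite dvdn_addl ?dvdnn //.
    by case d : (z - x)%N => [|e]; [lia | rewrite gtnNdvd //; lia].
  have lt_l0 : all (ltn^~ n) l0.
    by rewrite all_cat /= !all_nseq /= n_gt0 n_gt1 !orbT /=; lia.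
  (* Since [1 < x <= a < n - a = y], the entry [x] differs from [0], [1] and [y]. *)
  rewrite count_map (@eq_in_count _ _ (pred1 x)) => [|z /(allP lt_l0)]; last exact: mod_eq0.
  rewrite /l0 count_cat /= !count_nseq /= eqxx; lia.
- rewrite (@root_sum_mod _ [seq (z + (n - x)) | z <- l0]%N).
    by rewrite /root_sum inj_sum_shift ?cardsT ?card_ord // -/(root_sum l0) l0_0 mulr0.
  by rewrite -!map_comp; apply: eq_map => z /=; rewrite modn_mod.
Qed.

End RootOfUnity.

(** * From injective families to functions with prescribed fibres *)

Section Fibers.
Variables (F : comNzRingType) (n : nat) (w : F) (i0 : 'I_n).
Implicit Types (t : seq 'I_n) (V : {set 'I_n}) (f g : {ffun 'I_n -> 'I_n}).

(* Functions on [V] are represented by total functions with value [i0] off [V]. *)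
Definition has_fibers V t f :=
  [forall j, (j \in V) || (f j == i0)] &&
  [forall i, #|[set j in V | f j == i]| == count_mem i t].

(** Permuting equal entries of [t] does not change the resulting function on [V], so each function
    arises from as many families as the product of factorials. *)
Lemma inj_sum_fibers t V :
  size t = #|V| ->
  inj_sum w [seq val i | i <- t] V =
  (\prod_i (count_mem i t)`!)%:R *
  \sum_(f | has_fibers V t f) \prod_(j in V) w ^+ (f j * j).
Proof.
pose upd f j x : {ffun 'I_n -> 'I_n} := [ffun k => if k == j then x else f k].
elim: t V => [|x t IHt] V /= sz.
  have V0 := cards0_eq (esym sz).
  rewrite big1 ?mul1r => [|i _]; last by [].
  rewrite (big_pred1 [ffun=> i0]) => [|f]; first by rewrite V0 big_set0.
  rewrite /has_fibers V0; apply/andP/eqP => [[/forallP f0 _]|->].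
    by apply/ffunP => j; have := f0 j; rewrite inE ffunE /= => /eqP.
  split; apply/forallP => j; rewrite ?ffunE ?eqxx ?orbT //.
  by apply/eqP/eq_card0 => k; rewrite !inE.
have szD j : j \in V -> size t = #|V :\ j|.
  by move=> jV; move: sz; rewrite (cardsD1 j V) jV => -[].
have -> : (\prod_i ((x == i) + count_mem i t)`! =
           (count_mem x t).+1 * \prod_i (count_mem i t)`!)%N.
  rewrite (bigD1 x) //= eqxx factS [in RHS](bigD1 x) //= mulnA; congr (_ * _)%N.
  by apply: eq_bigr => i /negPf; rewrite eq_sym => ->.
rewrite natrM mulrAC mulrC.
(* Double counting: [j] is the index given to the head [x], one of the [(count_mem x t).+1] points
   of the fibre of [f] over [x]. *)
transitivity ((\prod_i (count_mem i t)`!)%:R *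
    \sum_(f | has_fibers V (x :: t) f) \sum_(j in V | f j == x)
       \prod_(k in V) w ^+ (f k * k)).
  rewrite (exchange_big_dep (mem V)) /=; last by move=> f j _ /andP[].
  rewrite big_distrr /=; apply: eq_bigr => j jV.
  rewrite (IHt _ (szD j jV)) mulrCA; congr (_ * _); rewrite big_distrr /=.
  (* Functions on [V] with value [x] at [j] correspond to functions on [V :\ j], with [j] reset to
     the default [i0]. *)
  rewrite [RHS](reindex_onto (fun g => upd g j x) (fun f => upd f j i0)) /=.
    apply: eq_big => [g|g _].
      have updj : (upd (upd g j x) j i0 == g) = (g j == i0).
        apply/eqP/eqP => [/ffunP/(_ j)|gj]; first by rewrite !ffunE eqxx.
        by apply/ffunP => k; rewrite !ffunE; case: eqP => // ->.
      have card_upd i : #|[set k in V | upd g j x k == i]|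
          = ((x == i) + #|[set k in V :\ j | g k == i]|)%N.
        rewrite (cardsD1 j) !inE jV ffunE eqxx /=; congr (_ + _)%N.
        by apply: eq_card => k; rewrite !inE ffunE; case: eqP.
      rewrite updj ffunE !eqxx andbT /has_fibers.
      rewrite jV andbT [RHS]andbAC; congr (_ && _); last first.
        apply: eq_forallb => i; rewrite card_upd eqn_add2l //.
      apply/forallP/andP => [g0|[/forallP g0 /eqP gj] k].
        split; last by have := g0 j; rewrite !inE eqxx.
        apply/forallP => k; rewrite ffunE; have [->|kj] := eqVneq k j; first by rewrite jV.
        by have := g0 k; rewrite !inE kj.
      by have := g0 k; rewrite !inE ffunE; have [->|] := eqVneq k j; rewrite // gj eqxx.
    rewrite [RHS](big_setD1 j) //= ffunE eqxx; congr (_ * _).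
    by apply: eq_bigr => k /setD1P[/negPf kj _]; rewrite ffunE kj.
  move=> f /andP[_ /andP[_ /eqP fj]]; apply/ffunP => k; rewrite !ffunE.
  by case: eqP => // ->.
congr (_ * _); rewrite big_distrr /=; apply: eq_bigr => f /andP[_ /forallP/(_ x)].
rewrite /= eqxx add1n => /eqP fx.
rewrite -fx sumr_const mulr_natl; congr (_ *+ _).
by apply: eq_card => j; rewrite !inE.
Qed.

End Fibers.

(** * Amplitudes of the Fourier matrix as injective sums *)

Section Amplitude.
Variables (R : realType) (n : nat).
Hypothesis n_gt0 : (0 < n)%N.
Local Notation C := R[i].

Lemma expr_cis (x : R) k :
  (cos x +i* sin x)%C ^+ k = (cos (x *+ k) +i* sin (x *+ k))%C.
Proof.
elim: k => [|k IHk]; first by rewrite expr0 mulr0n cos0 sin0.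
rewrite exprS IHk mulrS cosD sinD; simpc; congr (_ +i* _)%C; ring.
Qed.

Lemma omega_primitive : n.-primitive_root (omega R n).
Proof.
have nR_gt0 : 0 < n%:R :> R by rewrite ltr0n.
have wn : omega R n ^+ n = 1.
  by rewrite expr_cis -[_ *+ n]mulr_natr divfK ?gt_eqF // mulr_natl cos2pi sin2pi.
apply/andP; split=> //; apply/forallP => -[k lt_kn]; rewrite unity_rootE /=.
apply/eqP; have [->|ne_kn] := eqVneq k.+1 n; first by rewrite wn eqxx.
apply/negbTE/eqP; rewrite expr_cis => -[+ _].
(* Half the angle lies strictly between [0] and [pi], where [sin y] is positive, so [cos (2y) = 1]
   is impossible. *)
set y : R := pi / n%:R *+ k.+1.
have -> : 2 * pi / n%:R *+ k.+1 = y *+ 2 by rewrite /y mulrnAC mulr_natl mulrnAl.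
have y_bnd : 0 < y < pi.
  rewrite /y -mulr_natr mulr_gt0 ?divr_gt0 ?pi_gt0 ?ltr0n //=.
  rewrite mulrAC ltr_pdivrMr // ltr_pM2l ?pi_gt0 // ltr_nat.
  by rewrite ltn_neqAle ne_kn.
rewrite cos_mulr2n => cos2y; have := sin_gt0_pi y_bnd.
suff : sin y ^+ 2 == 0 by rewrite sqrf_eq0 => /eqP ->; rewrite ltxx.
by have := cos2Dsin2 y; apply: contra_eqT; lra.
Qed.

(** The two quantities differ only by nonzero factors: factorials, a square root and the
    normalisation [c ^+ n]. *)
Lemma amplitude_eq0 (s : 'I_n -> nat) (t : seq 'I_n) :
  size t = n -> (forall i, count_mem i t = s i) ->
  (amplitude (fourier R n) s == 0) =
  (root_sum n (omega R n) [seq val i | i <- t] == 0).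
Proof.
move=> szt cnt; pose i0 := Ordinal n_gt0.
rewrite /root_sum (@inj_sum_fibers _ _ _ i0) ?cardsT ?card_ord //.
rewrite /amplitude !mulf_eq0 pnatr_eq0.
have -> : (\prod_i (count_mem i t)`! == 0)%N = false.
  by apply/negbTE; rewrite -lt0n prodn_gt0 // => i; apply: fact_gt0.
have -> : ((Num.sqrt (\prod_(i < n) (s i)`!)%:R)%:C%C == 0 :> C) = false.
  rewrite (inj_eq (@complexI R) _ 0) gt_eqF // sqrtr_gt0 ltr0n.
  by rewrite prodn_gt0 // => i; apply: fact_gt0.
rewrite !orFb.
pose c : C := (Num.sqrt n%:R)^-1%:C%C.
have c_neq0 : c != 0.
  by rewrite (inj_eq (@complexI R) _ 0) invr_eq0 gt_eqF // sqrtr_gt0 ltr0n.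
pose S := \sum_(f | has_fibers i0 setT t f) \prod_(j in setT) omega R n ^+ (f j * j).
rewrite -[X in _ = (X == _)]/S; suff -> :
  \sum_(f : {ffun 'I_n -> 'I_n} | [forall i, #|[set j | f j == i]| == s i])
     \prod_(j < n) fourier R n (f j) j = c ^+ n * S.
  by rewrite mulf_eq0 expf_eq0 (negPf c_neq0) andbF.
rewrite /S big_distrr /=; apply: eq_big => [f|f _].
  rewrite /has_fibers.
  have -> /= : [forall j, (j \in [set: 'I_n]) || (f j == i0)].
    by apply/forallP => j; rewrite inE.
  apply: eq_forallb => i; rewrite cnt; congr (_ == _); apply: eq_card => j.
  by rewrite !inE.
rewrite [in RHS](eq_bigl xpredT) => [|j]; last by rewrite inE.
under eq_bigr => j _ do rewrite mxE.
by rewrite big_split /= prodr_const card_ord.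
Qed.
End Amplitude.

(** * Occupation numbers as multiplicities in a list of modes, and the conclusion *)

Lemma sum_count_mem (I : finType) (t : seq I) (G : I -> nat) :
  (\sum_(x <- t) G x = \sum_i G i * count_mem i t)%N.
Proof.
elim: t => [|x t IHt]; first by rewrite big_nil big1 // => i _; rewrite muln0.
rewrite [RHS](eq_bigr (fun i => G i * (x == i) + G i * count_mem i t)%N) => [|i _].
  rewrite big_cons IHt big_split /=; congr (_ + _)%N.
  rewrite (bigD1 x) //= eqxx muln1 big1 ?addn0 // => i.
  by rewrite eq_sym => /negPf ->; rewrite muln0.
by rewrite /= mulnDr.
Qed.

Lemma exists_count_mem (I : finType) (s : I -> nat) :
  exists t : seq I, forall i, count_mem i t = s i.
Proof.
exists (flatten [seq nseq (s i) i | i <- enum I]) => i.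
rewrite count_flatten sumnE !big_map -enumT (bigD1_seq i) ?mem_enum ?enum_uniq //=.
rewrite count_nseq /= eqxx mul1n.
by rewrite big1 ?addn0 // => j /negPf ji; rewrite count_nseq /= ji.
Qed.

Theorem theorem5 (R : realType) (n : nat) (hn : (2 <= n)%N) :
  (prime_power n ->
     (forall s : 'I_n -> nat, (\sum_(i < n) s i)%N = n ->
        (amplitude (fourier R n) s != 0 <->
         (\sum_(i < n) i * s i = 0 %[mod n])%N)) /\
     (forall s : 'I_n -> nat,
        ideal_pattern (fourier R n) s <->
        [/\ (\sum_(i < n) s i)%N = n,
            (forall i : 'I_n, nat_of_ord i = 0%N -> s i = 1%N) &
            (\sum_(i < n) i * s i = 0 %[mod n])%N])) /\
  (~ prime_power n ->
     exists s : 'I_n -> nat,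
       [/\ (\sum_(i < n) s i)%N = n,
           (forall i : 'I_n, nat_of_ord i = 0%N -> s i = 1%N),
           (\sum_(i < n) i * s i = 0 %[mod n])%N &
           amplitude (fourier R n) s = 0]).
Proof.
have n_gt0 : (0 < n)%N := ltnW hn.
have prim_w := omega_primitive R n_gt0.
have sum_val (t : seq 'I_n) : sumn [seq val i | i <- t] = (\sum_(i < n) i * count_mem i t)%N.
  by rewrite sumnE big_map sum_count_mem.
have size_count (t : seq 'I_n) : size t = (\sum_i count_mem i t)%N.
  by rewrite -sum1_size (sum_count_mem _ (fun=> 1%N)); apply: eq_bigr => i _; rewrite mul1n.
split=> [[p [v [p_pr [v_gt0 nE]]]]|npp].
  have ztl (s : 'I_n -> nat) : (\sum_(i < n) s i)%N = n ->
      (amplitude (fourier R n) s != 0 <-> (\sum_(i < n) i * s i = 0 %[mod n])%N).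
    move=> sum_s; have [t cnt] := exists_count_mem s.
    have szt : size t = n by rewrite size_count (eq_bigr _ (fun i _ => cnt i)).
    have -> : (\sum_(i < n) i * s i = sumn [seq val i | i <- t])%N.
      by rewrite sum_val; apply: eq_bigr => i _; rewrite cnt.
    rewrite (amplitude_eq0 R n_gt0 szt cnt); split=> [|/eqP].
      by apply: contraNeq => /eqP; rewrite mod0n => /eqP nd; apply/eqP/root_sum_eq0.
    rewrite mod0n => dvd_t; apply: root_sum_neq0 p_pr nE _ dvd_t => //.
    by rewrite size_map szt n_gt0 leqnn.
  split=> // s; split=> [[sum_s [s0 amp]]|[sum_s s0 /(ztl _ sum_s)]] //.
  by split=> //; apply/ztl.
have [l [szl lt_l dvd_l l0 Tl0]] := exists_root_sum_eq0 prim_w hn npp.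
(* All entries of [l] are below [n], so the default of [insubd] never occurs. *)
pose t := [seq insubd (Ordinal n_gt0) x | x <- l].
have tl : [seq val i | i <- t] = l.
  by rewrite -map_comp map_id_in // => x /(allP lt_l) lt_xn; rewrite /= insubdK.
exists (fun i => count_mem i t); split.
- by rewrite -size_count size_map.
- move=> i i0; rewrite -l0 -tl [RHS]count_map; apply: eq_count => j /=.
  by rewrite -val_eqE /= i0.
- by apply/eqP; rewrite -sum_val tl mod0n.
- by apply/eqP; rewrite (@amplitude_eq0 R n n_gt0 _ t) ?tl ?Tl0 // size_map.
Qed.
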